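(* The ROM propagator $\boldsymbol{\mathcal P}^{ROM}=\boldsymbol{R}^{-T}\boldsymbol{S}\boldsymbol{R}^{-1}\in\mathbb R^{nm\times nm}$ is symmetric and block tridiagonal (with $m\times m$ blocks), and the matrix $\boldsymbol{I}_{nm}-\boldsymbol{\mathcal P}^{ROM}$ is invertible. Therefore, the block lower triangular Cholesky factor $\boldsymbol{\mathcal L}^{ROM}$ in the block Cholesky factorization $$\frac{2}{\tau^2}\big(\boldsymbol{I}_{nm}-\boldsymbol{\mathcal P}^{ROM}\big)=\boldsymbol{\mathcal L}^{ROM}\,(\boldsymbol{\mathcal L}^{ROM})^T$$ is an invertible matrix with lower block bidiagonal structure.
   Context: Setting. $H$ is the real Hilbert space $L^2(\Omega)$ of (possibly vector valued) wave fields on a domain $\Omega\subset\mathbb R^d$. $L(q)$ is a first order partial differential operator (with homogeneous boundary conditions built into its domain) with adjoint $L(q)^T$. The results do not depend on the specific form of $L(q)$; what matters is that $L(q)L(q)^T$ is a self-adjoint nonnegative-definite operator on $H$. Let $\tau>0$ and let $m,n\ge1$ be integers. Wave propagator: $\mathcal P=\cos\big(\tau\sqrt{L(q)L(q)^T}\big)$, defined by functional calculus (a bounded self-adjoint operator on $H$ with spectrum in $[-1,1]$). Block conventions. An $m$-tuple $\boldsymbol{w}=(w^{(1)},\ldots,w^{(m)})$ of elements of $H$ is regarded as a row; operators act on it entrywise. For two $m$-tuples, $\langle\boldsymbol{v},\boldsymbol{w}\rangle$ is the $m\times m$ matrix with entries $\langle v^{(r)},w^{(s)}\rangle_H$. Matrices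 of size $nm\times nm$ are partitioned into $m\times m$ blocks, with block indices $0,\ldots,n-1$. Block tridiagonal means that blocks $(i,j)$ with $|i-j|\ge2$ vanish; lower block bidiagonal means that only blocks $(j,j)$ and $(j+1,j)$ may be nonzero. Snapshots. $\boldsymbol{b}=(b^{(1)},\ldots,b^{(m)})$ is a given $m$-tuple in $H$, and $\boldsymbol{u}_j=\cos\big(j\tau\sqrt{L(q)L(q)^T}\big)\boldsymbol{b}$, $j\ge0$. Standing assumption: the snapshots are linearly independent up to time $n\tau$, i.e. all the components of $\boldsymbol{u}_0,\ldots,\boldsymbol{u}_n$ are linearly independent in $H$. ROM. The mass and stiffness matrices $\boldsymbol{M},\boldsymbol{S}\in\mathbb R^{nm\times nm}$ have blocks $\boldsymbol{M}_{i,j}=\langle\boldsymbol{u}_i,\boldsymbol{u}_j\rangle$, $\boldsymbol{S}_{i,j}=\langle\boldsymbol{u}_i,\mathcal P\boldsymbol{u}_j\rangle$, $i,j=0,\ldots,n-1$. $\boldsymbol{M}$ is symmetric positive definite, and $\boldsymbol{M}=\boldsymbol{R}^T\boldsymbol{R}$ is a block Cholesky factorization, with $\boldsymbol{R}$ block upper triangular (invertible). $\boldsymbol{R}^{-T}$ denotes the transpose of $\boldsymbol{R}^{-1}$. *)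

(* Defs.v *)
From HB Require Import structures.
From mathcomp Require Import all_boot all_order all_algebra.
From mathcomp Require Import sesquilinear.
From mathcomp Require Import all_classical all_reals all_analysis.

Set Implicit Arguments.
Unset Strict Implicit.
Unset Printing Implicit Defensive.

Import Order.TTheory GRing.Theory Num.Theory.
Import numFieldNormedType.Exports.

Local Open Scope classical_set_scope.
Local Open Scope ring_scope.

Record hilbertSpace (R : realType) := HilbertSpace {
  hilbert_sort :> completeNormedModType R;
  inner : {dot hilbert_sort for idfun};
  sqr_normE : forall x, `|x| ^+ 2 = inner x x }.

(** Unbounded operators are represented by their graphs. *)
Section Operators.
Context {R : realType}.

Definition domain (K H : hilbertSpace R) (G : set (K * H)) : set K :=
  [set x | exists y, G (x, y)].

Definition densely_defined_operator (K H : hilbertSpace R) (G : set (K * H)) :=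
  [/\ G 0,
      forall (a : R) (p q : K * H), G p -> G q -> G (a *: p + q),
      forall x y y', G (x, y) -> G (x, y') -> y = y'
    & dense (domain G)].

Definition adjoint (K H : hilbertSpace R) (G : set (K * H)) : set (H * K) :=
  [set p | forall x y, G (x, y) -> inner H y p.1 = inner K x p.2].

Definition comp_op (H1 H2 H3 : hilbertSpace R)
    (G : set (H2 * H3)) (F : set (H1 * H2)) : set (H1 * H3) :=
  [set p | exists y, F (p.1, y) /\ G (y, p.2)].

Definition self_adjoint (H : hilbertSpace R) (A : set (H * H)) :=
  densely_defined_operator A /\ adjoint A = A.

Definition nonneg_op (H : hilbertSpace R) (A : set (H * H)) :=
  forall x y, A (x, y) -> 0 <= inner H y x.

End Operators.

(** Projection-valued measures on the Borel sets of the real line.  Outside the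
    Borel sets [spec_proj] is an arbitrary orthogonal projection, so that
    [spectral_weight] below is nonnegative on every set. *)
Record projMeasure (R : realType) (H : hilbertSpace R) := ProjMeasure {
  spec_proj :> set R -> {linear H -> H};
  spec_sym : forall B x y,
    inner H (spec_proj B x) y = inner H x (spec_proj B y);
  spec_idem : forall B x, spec_proj B (spec_proj B x) = spec_proj B x;
  spec_set0 : forall x, spec_proj set0 x = 0;
  spec_setT : forall x, spec_proj setT x = x;
  spec_setI : forall B C x, measurable B -> measurable C ->
    spec_proj (B `&` C) x = spec_proj B (spec_proj C x);
  spec_sigma_additive : forall x,
    semi_sigma_additive (fun B : set R => (inner H (spec_proj B x) x)%:E) }.

Section FunctionalCalculus.
Context {R : realType} {H : hilbertSpace R}.
Variable E : projMeasure H.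

Definition spectral_weight (x : H) (B : set R) : \bar R :=
  (inner H (E B x) x)%:E.

Let weight0 x : spectral_weight x set0 = 0%E.
Proof. by rewrite /spectral_weight spec_set0 linear0l. Qed.

Let weight_ge0 x B : (0 <= spectral_weight x B)%E.
Proof.
by rewrite /spectral_weight lee_fin -spec_idem spec_sym -sqr_normE sqr_ge0.
Qed.

HB.instance Definition _ x := isMeasure.Build _ R R (spectral_weight x)
  (weight0 x) (weight_ge0 x) (@spec_sigma_additive R H E x).

Definition in_spec_domain (f : R -> R) (x : H) : Prop :=
  (\int[spectral_weight x]_l ((f l) ^+ 2)%:E < +oo)%E.

(** The integral of [f] against the signed measure [B |-> <E(B) x, z>],
    by polarization. *)
Definition spec_pairing (f : R -> R) (x z : H) : R :=
  4^-1 * (Rintegral (spectral_weight (x + z)) setT f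
          - Rintegral (spectral_weight (x - z)) setT f).

(** The graph of the (possibly unbounded) operator [\int f dE]. *)
Definition spec_int (f : R -> R) : set (H * H) :=
  [set p | in_spec_domain f p.1 /\
    forall z, in_spec_domain f z -> inner H p.2 z = spec_pairing f p.1 z].

Definition spectral_measure_of (A : set (H * H)) := spec_int id = A.

(** When [E] is the spectral measure of a nonnegative self-adjoint [A],
    [is_cos_sqrt E t x y] says that y = cos(t sqrt A) x. *)
Definition is_cos_sqrt (t : R) (x y : H) : Prop :=
  spec_int (fun l => cos (t * Num.sqrt l)) (x, y).

End FunctionalCalculus.

(** Square matrices of size nm partitioned into n x n blocks of size m x m,
    in the sense of [mxblock] and [submxblock]; the size [\sum_(i < n) m] is nm
    by [sum_nat_const]. *)
Notation blockmx R n m := 'M[R]_(\sum_(i < n) m).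

Section Blocks.
Context {R : realType} {n m : nat}.
Implicit Type A : blockmx R n m.

Definition block_upper_triangular A :=
  forall i j : 'I_n, (j < i)%N -> submxblock A i j = 0.

Definition block_lower_triangular A :=
  forall i j : 'I_n, (i < j)%N -> submxblock A i j = 0.

Definition block_tridiagonal A :=
  forall i j : 'I_n, (i.+1 < j)%N || (j.+1 < i)%N -> submxblock A i j = 0.

Definition block_lower_bidiagonal A :=
  forall i j : 'I_n, ~~ ((i == j) || (i == j.+1 :> nat)) ->
    submxblock A i j = 0.

Definition block_cholesky_lower A (C : blockmx R n m) :=
  block_lower_triangular C /\ A = C *m C^T.

Definition block_cholesky_upper A (C : blockmx R n m) :=
  block_upper_triangular C /\ A = C^T *m C.

End Blocks.

Section ROM.
Context {R : realType} {H : hilbertSpace R}.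

Definition gram (m : nat) (v w : 'I_m -> H) : 'M[R]_m :=
  \matrix_(r < m, s < m) inner H (v r) (w s).

Definition lin_indep_upto (n m : nat) (u : nat -> 'I_m -> H) :=
  forall c : 'I_n.+1 -> 'I_m -> R,
    \sum_(j < n.+1) \sum_(r < m) c j r *: u j r = 0 ->
    forall j r, c j r = 0.

Definition mass_mx (n m : nat) (u : nat -> 'I_m -> H) : blockmx R n m :=
  \mxblock_(i < n, j < n) gram (u i) (u j).

Definition stiffness_mx (n m : nat) (P : H -> H) (u : nat -> 'I_m -> H) :
    blockmx R n m :=
  \mxblock_(i < n, j < n) gram (u i) (P \o u j).

Definition rom_propagator (n m : nat) (S C : blockmx R n m) : blockmx R n m :=
  (invmx C)^T *m S *m invmx C.

End ROM.

(* Main.v *)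
Require Import Defs.
From HB Require Import structures.
From mathcomp Require Import all_boot all_order all_algebra.
From mathcomp Require Import sesquilinear.
From mathcomp Require Import all_classical all_reals all_analysis.
From mathcomp Require Import measurable_realfun ring lra.
Import Order.TTheory GRing.Theory Num.Theory.
Import numFieldNormedType.Exports.
Local Open Scope classical_set_scope.
Local Open Scope ring_scope.

Set Implicit Arguments.
Unset Strict Implicit.
Unset Printing Implicit Defensive.

(** Write V for the basis obtained from the snapshots u_0, ..., u_(n-1) by the
    inverse Cholesky factor.  It is orthonormal, and the ROM propagator is the
    matrix of the compression of P to the space that it spans: its entries are
    <V_s, P V_t> ([rom_propagatorE]).  Everything follows from four properties
    of P = cos(tau sqrt A).

    - P is symmetric, hence so is the ROM propagator.
    - P u_0 = u_1 and 2 P u_j = u_(j+1) + u_(j-1), the product formula for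
      cosines.  So P maps the span of the snapshots before time k into the span
      of those before time k+1.  The inverse of a block upper triangular matrix
      is block upper triangular, so V_t is a combination of snapshots up to the
      time of its block, whereas V_s is orthogonal to all snapshots of earlier
      times: <V_s, P V_t> = 0 if the block of s is at least two after that of
      t ([rom_propagator_tridiagonal]).
    - <P x, x> <= <x, x>, because cosines are at most 1; so the form
      <x, (I - P) x> is nonnegative, and it vanishes only at fixed points of P.
    - P has no nonzero fixed point in the span of u_0, ..., u_(n-1): if u_k is
      the last snapshot that occurs in x, then u_(k+1) occurs in P x and not in
      x, and k + 1 <= n ([propagator_fixed_eq0]).  Hence I - P is
      positive definite on that span, and I - PROM is a positive definite
      matrix ([rom_propagator_posdef]).

    A positive definite matrix G has a lower triangular factor L, which is block
    lower triangular; and for every block lower triangular factor,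
    L = G L^(-T) is the product of a block tridiagonal and a block upper
    triangular matrix, so that it vanishes below the first block subdiagonal
    ([tridiagonal_cholesky]).

    The product formula is where the functional calculus enters.  Operators are
    given weakly, by <f(A) x, z> = \int f dE_(x,z), and multiplicativity of
    f |-> f(A) on bounded functions ([spec_pairingM]) is obtained from the case
    of indicators by a uniqueness principle for bounded linear functionals
    ([bounded_functional_eq0]). *)

(** * Functionals of bounded measurable functions *)

Section BoundedMeasurable.
Context {R : realType}.
Implicit Types (f g : R -> R) (B : set R).

Definition bounded_measurable f :=
  measurable_fun setT f /\ exists M, forall l, `|f l| <= M.

Lemma bounded_measurable_indic B :
  measurable B -> bounded_measurable (\1_B : R -> R).
Proof.
move=> mB; split; first exact: measurable_indic.
by exists 1 => l; rewrite indicE; case: (l \in B); rewrite ?normr1 ?normr0.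
Qed.

Lemma bounded_measurableZD a f g : bounded_measurable f ->
  bounded_measurable g -> bounded_measurable (fun l => a * f l + g l).
Proof.
move=> [mf [M fM]] [mg [N gN]]; split.
  by apply: measurable_funD => //; apply: measurable_funM.
exists (`|a| * M + N) => l; apply: (le_trans (ler_normD _ _)).
by rewrite normrM lerD// ler_wpM2l.
Qed.

Lemma bounded_measurableM f g : bounded_measurable f ->
  bounded_measurable g -> bounded_measurable (fun l => f l * g l).
Proof.
move=> [mf [M fM]] [mg [N gN]]; split; first exact: measurable_funM.
by exists (M * N) => l; rewrite normrM ler_pM.
Qed.

(** A linear functional that is bounded for the sup norm is determined by its
    values on indicators.  If it kills them, subtracting from [f] the two-step
    function with values M/2 where [f >= 0] and -M/2 elsewhere keeps the value
    of the functional and halves the bound M of [f]; this can be repeated. *)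
Lemma bounded_functional_eq0 (D : (R -> R) -> R) (c : R) :
    (forall a f g, bounded_measurable f -> bounded_measurable g ->
       D (fun l => a * f l + g l) = a * D f + D g) ->
    (forall (M : R) f, bounded_measurable f -> (forall l, `|f l| <= M) ->
       `|D f| <= c * M) ->
    (forall B, measurable B -> D \1_B = 0) ->
  forall f, bounded_measurable f -> D f = 0.
Proof.
move=> D_lin D_bd D_ind f bf.
have halve k : forall (M : R) g, bounded_measurable g ->
    (forall l, `|g l| <= M) -> `|D g| <= c * (M / 2 ^+ k).
  elim: k => [|k IH] M g bg gM; first by rewrite expr0 divr1; exact: D_bd.
  pose U := [set l | 0 <= g l].
  have mU : measurable U.
    have -> : U = setT `&` g @^-1` `[0, +oo[.
      by rewrite setTI; apply/seteqP; split=> l /=; rewrite in_itv/= andbT.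
    by apply: bg.1 => //; exact: measurable_itv.
  have mU' : measurable (~` U) by exact: measurableC.
  have bU := bounded_measurable_indic mU.
  have bU' := bounded_measurable_indic mU'.
  have -> : D g = D (fun l => - (M / 2) * \1_U l + (M / 2 * \1_(~` U) l + g l)).
    rewrite (D_lin _ _ _ bU (bounded_measurableZD _ bU' bg)).
    by rewrite (D_lin _ _ _ bU' bg) !D_ind// !mulr0 !add0r.
  have -> : M / 2 ^+ k.+1 = M / 2 / 2 ^+ k by rewrite exprS invfM mulrA.
  apply: IH; first by do 2 apply: bounded_measurableZD => //.
  move=> l; have /ler_normlP[gM1 gM2] := gM l.
  rewrite !indicE in_setC; have [lU|lU] := boolP (l \in U).
    by move: lU; rewrite inE /U/= => ?; apply/ler_normlP; split; lra.
  have : ~ U l by move: lU; rewrite notin_setE.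
  by rewrite /U/= => /negP; rewrite -ltNge => ?; apply/ler_normlP; split; lra.
have [M fM] := bf.2.
apply/eqP; rewrite -normr_le0.
have lim0 : geometric (c * M) (2^-1) @ \oo --> (0 : R).
  by apply: cvg_geometric; rewrite ger0_norm ?invf_lt1 ?ltr1n.
apply: (cvgr_to_ge lim0); near=> k.
by rewrite /geometric/= exprVn -mulrA; exact: halve.
Unshelve. all: by end_near.
Qed.

End BoundedMeasurable.

(** * The inner product *)

Local Notation "''[' x , y ]" := (inner _ x y) : ring_scope.

Section InnerProduct.
Context {R : realType} {H : hilbertSpace R}.
Implicit Types x y z : H.

Lemma innerC x y : '[x, y] = '[y, x].
Proof. by rewrite hermC expr0 mul1r. Qed.

Lemma innerZl a x y : '[a *: x, y] = a * '[x, y].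
Proof. exact: linearZl_LR. Qed.

Lemma innerZr a x y : '[x, a *: y] = a * '[x, y].
Proof. exact: linearZr_LR. Qed.

Lemma innerDl x y z : '[x + y, z] = '[x, z] + '[y, z].
Proof. exact: linearDl. Qed.

Lemma innerDr x y z : '[x, y + z] = '[x, y] + '[x, z].
Proof. exact: linearDr. Qed.

Lemma innerNl x y : '[- x, y] = - '[x, y].
Proof. exact: linearNl. Qed.

Lemma innerNr x y : '[x, - y] = - '[x, y].
Proof. exact: linearNr. Qed.

Lemma inner_ge0 x : 0 <= '[x, x].
Proof. by rewrite -sqr_normE sqr_ge0. Qed.

Lemma inner_inj x y : (forall z, '[x, z] = '[y, z]) -> x = y.
Proof.
move=> xy; apply/eqP; rewrite -subr_eq0 -normr_eq0 -sqrf_eq0 sqr_normE.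
by rewrite innerDl innerNl xy subrr.
Qed.

Lemma polarization (T : {linear H -> H}) x z :
    (forall v w, '[T v, w] = '[v, T w]) ->
  '[T x, z] = 4^-1 * ('[T (x + z), x + z] - '[T (x - z), x - z]).
Proof.
move=> T_sym; have := T_sym z x; rewrite (innerC z) => Tzx.
rewrite (linearD T) (linearB T) /= !(innerDl, innerNl, innerDr, innerNr).
by rewrite Tzx; field.
Qed.

End InnerProduct.

(** * Functional calculus of bounded functions *)

Section Pairing.
Context {R : realType} {H : hilbertSpace R} (E : projMeasure H).
Implicit Types (f g : R -> R) (B : set R) (x y z : H).

Lemma spectral_weight_integrable f x : bounded_measurable f ->
  (spectral_weight E x).-integrable setT (EFin \o f).
Proof.
move=> [mf [M fM]]; apply: measurable_bounded_integrable => //.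
  by rewrite /spectral_weight/= ltry.
exists M; split; first exact: num_real.
by move=> M' MM' l _; exact: (le_trans (fM l) (ltW MM')).
Qed.

Lemma spec_pairing_sym f x z : spec_pairing E f x z = spec_pairing E f z x.
Proof.
rewrite /spec_pairing (addrC x z) -(opprB z x); congr (_ * (_ - _)).
rewrite /Rintegral; congr fine.
apply: eq_measure_integral => B _ _.
by rewrite /= /spectral_weight (linearN (E B)) innerNl innerNr opprK.
Qed.

Lemma eq_spec_pairing f g x z :
  f =1 g -> spec_pairing E f x z = spec_pairing E g x z.
Proof. by move=> /funext ->. Qed.

Lemma spec_pairingZD a f g x z : bounded_measurable f -> bounded_measurable g ->
  spec_pairing E (fun l => a * f l + g l) x z =
  a * spec_pairing E f x z + spec_pairing E g x z.
Proof.
move=> bf bg; rewrite /spec_pairing.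
have b0 : bounded_measurable (fun=> 0 : R).
  by split; [exact: measurable_cst | exists 0 => l; rewrite normr0].
have baf : bounded_measurable (fun l => a * f l).
  have -> : (fun l => a * f l) = (fun l => a * f l + 0).
    by apply/funext => l; rewrite addr0.
  exact: bounded_measurableZD.
have lin v : Rintegral (spectral_weight E v) setT (fun l => a * f l + g l) =
    a * Rintegral (spectral_weight E v) setT f +
    Rintegral (spectral_weight E v) setT g.
  rewrite RintegralD//; last exact: spectral_weight_integrable.
    by rewrite RintegralZl//; exact: spectral_weight_integrable.
  exact: (spectral_weight_integrable _ baf).
by rewrite !lin; ring.
Qed.

Definition pairing_bound x z : R :=
  4^-1 * ('[x + z, x + z] + '[x - z, x - z]).

Lemma spec_pairing_le (M : R) f x z : bounded_measurable f ->
    (forall l, `|f l| <= M) ->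
  `|spec_pairing E f x z| <= M * pairing_bound x z.
Proof.
move=> bf fM.
have bd v : `|Rintegral (spectral_weight E v) setT f| <= M * '[v, v].
  have iM : (spectral_weight E v).-integrable setT (EFin \o cst M).
    apply: spectral_weight_integrable; split; first exact: measurable_cst.
    by exists `|M|.
  have if_ := spectral_weight_integrable v bf.
  apply: (le_trans (le_normr_Rintegral _ if_)) => //.
  apply: (@le_trans _ _ (Rintegral (spectral_weight E v) setT (cst M))).
    by apply: le_Rintegral => //; exact: integrable_norm.
  by rewrite Rintegral_cst//= spec_setT.
rewrite /spec_pairing /pairing_bound normrM ger0_norm ?invr_ge0// mulrCA.
rewrite ler_wpM2l ?invr_ge0//.
by apply: (le_trans (ler_normB _ _)); rewrite mulrDr lerD.
Qed.

Lemma spec_pairing_indic B x z : measurable B ->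
  spec_pairing E \1_B x z = '[E B x, z].
Proof.
move=> mB.
have ind v : Rintegral (spectral_weight E v) setT \1_B = '[E B v, v].
  by rewrite /Rintegral integral_indic// setIT.
rewrite /spec_pairing !ind -(polarization x z) //.
by move=> v w; rewrite spec_sym.
Qed.

(** Multiplicativity when one of the two functions is an indicator.  For a second
    indicator this is multiplicativity of the projections; both sides are
    bounded linear functionals of [f]. *)
Lemma spec_pairing_proj f B x z : bounded_measurable f -> measurable B ->
  spec_pairing E f x (E B z) = spec_pairing E (fun l => f l * \1_B l) x z.
Proof.
move=> bf mB; have bB := bounded_measurable_indic mB.
apply/eqP; rewrite -subr_eq0; apply/eqP.
pose D g :=
  spec_pairing E g x (E B z) - spec_pairing E (fun l => g l * \1_B l) x z.
rewrite -[LHS]/(D f).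
pose c := pairing_bound x (E B z) + pairing_bound x z.
apply: (@bounded_functional_eq0 _ D c) bf; rewrite /D.
- move=> a g h bg bh; rewrite (spec_pairingZD _ _ _ bg bh).
  rewrite (@eq_spec_pairing (fun l => (a * g l + h l) * \1_B l)
    (fun l => a * (g l * \1_B l) + h l * \1_B l)); last by move=> l; ring.
  rewrite spec_pairingZD; [ring | exact: bounded_measurableM..].
- move=> M g bg gM; apply: (le_trans (ler_normB _ _)).
  rewrite mulrC mulrDr lerD//; first exact: spec_pairing_le.
  apply: spec_pairing_le; first exact: bounded_measurableM.
  move=> l; rewrite indicE normrM; case: (l \in B).
    by rewrite normr1 mulr1.
  by rewrite normr0 mulr0 (le_trans _ (gM l)).
- move=> C mC; rewrite spec_pairing_indic//.
  rewrite (@eq_spec_pairing _ (\1_(B `&` C))); last first.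
    by move=> l; rewrite indicI/= mulrC.
  rewrite spec_pairing_indic; last exact: measurableI.
  by rewrite spec_setI// -spec_sym subrr.
Qed.

(** A bounded function has the whole space as its domain, so that the weak
    formula for the operator can be tested against every vector. *)
Lemma spec_int_pairing f x y : bounded_measurable f -> spec_int E f (x, y) ->
  forall z, '[y, z] = spec_pairing E f x z.
Proof.
move=> bf [_ /= pairE] z; apply: pairE; rewrite /in_spec_domain.
have b2 := bounded_measurableM bf bf.
have /integrableP[_ fin] := spectral_weight_integrable z b2.
apply: le_lt_trans fin; apply: ge0_le_integral => //=.
- by move=> l _; rewrite lee_fin sqr_ge0.
- by apply/measurable_EFinP; exact: b2.1.
- by apply/measurable_EFinP; apply: measurableT_comp => //; exact: b2.1.
- by move=> l _; rewrite lee_fin expr2 ler_norm.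
Qed.

(** Multiplicativity of the calculus, in weak form: with y = g(A) b and
    P = f(A), the vector y enters only through its pairings
    <y, w> = \int g dE_(b,w), and w = P z is one such test vector.  Both sides
    are thus bounded linear functionals of [g], and for an indicator the
    equality is [spec_pairing_proj] applied to [f]. *)
Lemma spec_pairingM f g (P : H -> H) b y z :
    bounded_measurable f -> bounded_measurable g ->
    (forall x, spec_int E f (x, P x)) -> spec_int E g (b, y) ->
  '[y, P z] = spec_pairing E (fun l => f l * g l) z b.
Proof.
move=> bf bg fP gy; rewrite (spec_int_pairing bg gy).
have PE x w := spec_int_pairing bf (fP x) w.
apply/eqP; rewrite -subr_eq0; apply/eqP.
have [M fM] := bf.2; have M0 : 0 <= M := le_trans (normr_ge0 _) (fM 0).
pose D h := spec_pairing E h b (P z) - spec_pairing E (fun l => f l * h l) z b.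
rewrite -[LHS]/(D g).
pose c := pairing_bound b (P z) + M * pairing_bound z b.
apply: (@bounded_functional_eq0 _ D c) bg; rewrite /D.
- move=> a h k bh bk; rewrite (spec_pairingZD _ _ _ bh bk).
  rewrite (@eq_spec_pairing (fun l => f l * (a * h l + k l))
    (fun l => a * (f l * h l) + f l * k l)); last by move=> l; ring.
  rewrite spec_pairingZD; [ring | exact: bounded_measurableM..].
- move=> N h bh hN; apply: (le_trans (ler_normB _ _)).
  rewrite mulrC mulrDr lerD//; first exact: spec_pairing_le.
  rewrite mulrA (mulrC N); apply: spec_pairing_le.
    exact: bounded_measurableM.
  by move=> l; rewrite normrM ler_pM.
- move=> C mC; rewrite spec_pairing_indic// innerC PE spec_pairing_proj//.
  by rewrite subrr.
Qed.

End Pairing.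

(** * The propagator and its snapshots *)

Section Propagator.
Context {R : realType} {H : hilbertSpace R} (E : projMeasure H).

Lemma bounded_measurable_cos_sqrt (t : R) :
  bounded_measurable (fun l => cos (t * Num.sqrt l)).
Proof.
split; last by exists 1 => l; rewrite ler_norml cos_geN1 cos_le1.
apply: continuous_measurable_fun => l.
apply: (@continuous_comp _ _ _ (fun l => t * Num.sqrt l) cos); last first.
  exact: continuous_cos.
by apply: continuousM; [exact: cst_continuous | exact: sqrt_continuous].
Qed.

Variables (tau : R) (P : H -> H).
Hypothesis hP : forall x, is_cos_sqrt E tau x (P x).

Let bt := bounded_measurable_cos_sqrt tau.
Let PE x := spec_int_pairing bt (hP x).

Lemma cos_propagator_sym x z : '[P x, z] = '[x, P z].
Proof. by rewrite PE spec_pairing_sym -PE innerC. Qed.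

(** Only a pointwise relation with an operator defined everywhere is given;
    linearity is a consequence of symmetry. *)
Lemma cos_propagator_linear a x y : P (a *: x + y) = a *: P x + P y.
Proof.
apply: inner_inj => z.
by rewrite innerDl innerZl !cos_propagator_sym innerDl innerZl.
Qed.

Lemma cos_propagator_le x : '[P x, x] <= '[x, x].
Proof.
rewrite PE; apply: (le_trans (ler_norm _)).
have cos_le l : `|cos (tau * Num.sqrt l)| <= 1.
  by rewrite ler_norml cos_geN1 cos_le1.
apply: (le_trans (spec_pairing_le E x x bt cos_le)).
by rewrite mul1r /pairing_bound !(innerDl, innerDr, innerNl, innerNr); lra.
Qed.

Lemma cos_propagatorM (s : R) b y : is_cos_sqrt E s b y ->
  forall z, '[P y, z] = spec_pairing E
    (fun l => cos (tau * Num.sqrt l) * cos (s * Num.sqrt l)) b z.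
Proof.
move=> hy z; rewrite cos_propagator_sym spec_pairing_sym.
exact: (spec_pairingM z bt (bounded_measurable_cos_sqrt s) hP hy).
Qed.

Variables (b : H) (v : nat -> H).
Hypothesis hv : forall j, is_cos_sqrt E (j%:R * tau) b (v j).

Let vE j := spec_int_pairing (bounded_measurable_cos_sqrt (j%:R * tau)) (hv j).

Lemma cos_propagator0 : P (v 0) = v 1.
Proof.
apply: inner_inj => z; rewrite (cos_propagatorM (hv 0)) vE.
by apply: eq_spec_pairing => l; rewrite !mul0r cos0 mulr1 mul1r.
Qed.

(** The three-term recursion is cos(x + y) + cos(x - y) = 2 cos(x) cos(y) with
    y = tau sqrt l and x = (j + 1) y. *)
Lemma cos_propagatorS j : P (v j.+1) = 2^-1 *: (v j.+2 + v j).
Proof.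
apply: inner_inj => z; rewrite (cos_propagatorM (hv j.+1)).
rewrite innerZl innerDl !vE.
set p := (fun l => cos (tau * _) * _).
pose f i l := cos (i%:R * tau * Num.sqrt l).
have bf i : bounded_measurable (f i) := bounded_measurable_cos_sqrt _.
have bp : bounded_measurable p := bounded_measurableM bt (bf j.+1).
have : spec_pairing E (f j.+2) b z + spec_pairing E (f j) b z =
    spec_pairing E p b z + spec_pairing E p b z.
  rewrite -[X in X + _ = _]mul1r -[X in _ = X + _]mul1r -!spec_pairingZD//.
  apply: eq_spec_pairing => l; rewrite /f /p !mul1r.
  have -> : j.+2%:R * tau * Num.sqrt l =
      j.+1%:R * tau * Num.sqrt l + tau * Num.sqrt l.
    by rewrite -[j.+2%:R]natr1; ring.
  have -> : j%:R * tau * Num.sqrt l =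
      j.+1%:R * tau * Num.sqrt l - tau * Num.sqrt l.
    by rewrite -[j.+1%:R]natr1; ring.
  by rewrite cosD cosB; ring.
by rewrite -/(f j.+2) -/(f j) => ->; field.
Qed.

End Propagator.

(** * The spans of the successive snapshots *)

Section SnapshotSpans.
Context {R : realType} {H : hilbertSpace R} {m : nat}.
Variable u : nat -> 'I_m -> H.
Implicit Types (k n : nat) (x y : H).

Definition snapshot_span k x :=
  exists c : nat -> 'I_m -> R, x = \sum_(j < k) \sum_(r < m) c j r *: u j r.

Lemma snapshot_spanZD k a x y :
  snapshot_span k x -> snapshot_span k y -> snapshot_span k (a *: x + y).
Proof.
move=> [c ->] [d ->]; exists (fun j r => a * c j r + d j r).
rewrite scaler_sumr -big_split; apply: eq_bigr => j _ /=.
rewrite scaler_sumr -big_split; apply: eq_bigr => r _ /=.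
by rewrite scalerDl scalerA.
Qed.

Lemma snapshot_span0 k : snapshot_span k 0.
Proof.
exists (fun _ _ => 0); rewrite big1// => j _.
by rewrite big1// => r _; rewrite scale0r.
Qed.

Lemma snapshot_spanZ k a x : snapshot_span k x -> snapshot_span k (a *: x).
Proof.
move=> kx; rewrite -[_ *: _]addr0.
exact: snapshot_spanZD (snapshot_span0 k).
Qed.

Lemma snapshot_spanD k x y :
  snapshot_span k x -> snapshot_span k y -> snapshot_span k (x + y).
Proof. by rewrite -[x in x + y]scale1r; exact: snapshot_spanZD. Qed.

Lemma snapshot_span_sum k (I : finType) (F : I -> H) :
  (forall i, snapshot_span k (F i)) -> snapshot_span k (\sum_i F i).
Proof.
move=> kF; apply: big_ind => // [|x y]; first exact: snapshot_span0.
exact: snapshot_spanD.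
Qed.

Lemma snapshot_span_gen k j r : (j < k)%N -> snapshot_span k (u j r).
Proof.
move=> jk; exists (fun i s => ((i == j) && (s == r))%:R).
rewrite (bigD1 (Ordinal jk))//= (bigD1 r)//= !eqxx scale1r.
rewrite !big1 ?addr0// => [i /negPf ij|s /negPf ->]; last first.
  by rewrite andbF scale0r.
rewrite big1// => s _.
by have -> : (i == j :> nat) = false by []; rewrite scale0r.
Qed.

Lemma snapshot_span_ind k (Q : H -> Prop) :
    Q 0 -> (forall a x y, Q x -> Q y -> Q (a *: x + y)) ->
    (forall j r, (j < k)%N -> Q (u j r)) ->
  forall x, snapshot_span k x -> Q x.
Proof.
move=> Q0 QZD Qu _ [c ->].
have QD x y : Q x -> Q y -> Q (x + y).
  by rewrite -[x in x + y]scale1r; exact: QZD.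
apply: big_ind => // j _; apply: big_ind => // r _.
by rewrite -[_ *: _]addr0; apply: QZD => //; exact: Qu.
Qed.

Lemma snapshot_span_le k l x :
  (k <= l)%N -> snapshot_span k x -> snapshot_span l x.
Proof.
move=> kl; apply: snapshot_span_ind.
- exact: snapshot_span0.
- by move=> *; exact: snapshot_spanZD.
by move=> j r jk; apply: snapshot_span_gen; exact: leq_trans kl.
Qed.

Lemma snapshot_span_recr k x : snapshot_span k.+1 x ->
  exists y d, snapshot_span k y /\ x = y + \sum_(r < m) d r *: u k r.
Proof.
by move=> [c ->]; rewrite big_ord_recr/=; do 2 eexists; split; [exists c|].
Qed.

Lemma snapshot_top_eq0 n k y (d : 'I_m -> R) :
    lin_indep_upto n u -> (k <= n)%N -> snapshot_span k y ->
    y + \sum_(r < m) d r *: u k r = 0 ->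
  forall r, d r = 0.
Proof.
move=> indep kn [c ->] eq0 r.
pose e (j : 'I_n.+1) r :=
  if (j < k)%N then c j r else if j == k :> nat then d r else 0.
have kn' : (k < n.+1)%N by [].
suff : e (Ordinal kn') r = 0 by rewrite /e /= ltnn eqxx.
apply: indep; rewrite -[RHS]eq0.
rewrite (bigID (fun j : 'I_n.+1 => (j < k)%N))/=; congr (_ + _).
  rewrite (big_ord_widen _ (fun j => \sum_(r < m) c j r *: u j r) (leqW kn)).
  by apply: eq_bigr => j jk; rewrite /e jk.
rewrite (bigD1 (Ordinal kn')) ?ltnn//= [X in _ + X]big1 ?addr0.
  by apply: eq_bigr => s _; rewrite /e/= ltnn eqxx.
move=> j /andP[/negPf jk /negPf jk']; rewrite big1// => s _.
by rewrite /e jk; have -> : (j == k :> nat) = false by []; rewrite scale0r.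
Qed.

Variable P : {linear H -> H}.
Hypothesis P0 : forall r, P (u 0 r) = u 1 r.
Hypothesis PS : forall j r, P (u j.+1 r) = 2^-1 *: (u j.+2 r + u j r).

(** The coefficient is 1 at time 0 and 1/2 afterwards: P moves every
    snapshot strictly forward in time. *)
Lemma propagator_shift k : exists2 a : R, a != 0 &
  forall r, snapshot_span k (P (u k r) - a *: u k.+1 r).
Proof.
case: k => [|j].
  exists 1 => [|r]; first exact: oner_neq0.
  by rewrite P0 scale1r subrr; exact: snapshot_span0.
exists 2^-1; first by rewrite invr_neq0// pnatr_eq0.
move=> r; rewrite PS scalerDr addrC addrA addNr add0r.
by apply: snapshot_spanZ; exact: snapshot_span_gen.
Qed.

Lemma propagator_span k x : snapshot_span k x -> snapshot_span k.+1 (P x).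
Proof.
apply: (snapshot_span_ind (Q := fun y => snapshot_span k.+1 (P y)));
  [|move=> a y z Py Pz|move=> j r jk].
- by rewrite linear0; exact: snapshot_span0.
- by rewrite linearP; exact: snapshot_spanZD.
have [a _ /(_ r) shift] := propagator_shift j.
rewrite -[P _](subrK (a *: u j.+1 r)); apply: snapshot_spanD.
  exact: snapshot_span_le (leqW (ltnW jk)) shift.
by apply: snapshot_spanZ; exact: snapshot_span_gen.
Qed.

(** If x = y + sum_r d_r u_(k,r) with y in the span of the snapshots before time
    k, then in P x - x = 0 the snapshots of time k + 1 have the coefficients
    a d_r with a nonzero, so that d = 0 by independence; the induction then
    continues with y.  The last use, k + 1 = n, is why independence is needed
    up to time n although x involves earlier snapshots only. *)
Lemma propagator_fixed_eq0 n x :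
  lin_indep_upto n u -> snapshot_span n x -> P x = x -> x = 0.
Proof.
move=> indep; suff fixed k : (k <= n)%N -> forall y,
    snapshot_span k y -> P y = y -> y = 0 by exact: fixed.
move=> {x}; elim: k => [|k IH] kn x; first by case=> c ->; rewrite big_ord0.
move=> /snapshot_span_recr[y [d [yk xE]]] Px.
have [a a0 shift] := propagator_shift k.
have d0 : forall r, a * d r = 0.
  (* The part of P x - x in the span of the snapshots up to time k. *)
  pose w := P y - x + \sum_r d r *: (P (u k r) - a *: u k.+1 r).
  apply: (@snapshot_top_eq0 n k.+1 w _ indep kn).
    apply: snapshot_spanD; last first.
      apply: snapshot_span_sum => r; apply: snapshot_spanZ.
      exact: snapshot_span_le (shift r).
    apply: snapshot_spanD; first exact: propagator_span.
    rewrite xE -scaleN1r; apply: snapshot_spanZ; apply: snapshot_spanD.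
      exact: snapshot_span_le yk.
    apply: snapshot_span_sum => r; apply: snapshot_spanZ.
    exact: snapshot_span_gen.
  rewrite /w -addrA -big_split/=.
  under eq_bigr => r _ do rewrite scalerBr scalerA (mulrC a) subrK.
  have -> : \sum_r d r *: P (u k r) = P (\sum_r d r *: u k r).
    by rewrite linear_sum; apply: eq_bigr => r _; rewrite linearZ.
  by rewrite addrAC -linearD -xE Px subrr.
have {}d0 r : d r = 0 by have /eqP := d0 r; rewrite mulf_eq0 (negPf a0) => /eqP.
have xy : x = y by rewrite xE big1 ?addr0// => r _; rewrite d0 scale0r.
by apply: IH (ltnW kn) _ _ Px; rewrite xy.
Qed.

Hypothesis P_sym : forall x y, '[P x, y] = '[x, P y].
Hypothesis P_le : forall x, '[P x, x] <= '[x, x].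

(** The form <x, (I - P) x> is nonnegative, so that the vectors where it vanishes
    are in the kernel of I - P, as in the Cauchy-Schwarz inequality. *)
Lemma sub_propagator_gt0 n x : lin_indep_upto n u -> snapshot_span n x ->
  x != 0 -> 0 < '[x, x - P x].
Proof.
move=> indep xn x0.
have Q_ge0 y : 0 <= '[y, y - P y].
  by rewrite innerDr innerNr -P_sym subr_ge0.
rewrite lt_neqAle Q_ge0 andbT; apply: contra_neq x0 => /esym Qx0.
apply: (propagator_fixed_eq0 indep xn).
(* The form is evaluated at x - t w, with w = (I - P) x. *)
have [w wE] : {w | w = x - P x} by exists (x - P x).
apply/esym/eqP; rewrite -subr_eq0 -wE; rewrite -wE in Qx0.
have expand s : '[x + s *: w, x + s *: w - P (x + s *: w)] =
    2 * s * '[w, w] + s ^+ 2 * '[w, w - P w].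
  have -> : x + s *: w - P (x + s *: w) = w + s *: (w - P w).
    by rewrite (linearD P) linearZ (scalerBr s w (P w)) opprD addrACA -wE.
  have xPw : '[x, w - P w] = '[w, w].
    by rewrite innerDr innerNr -P_sym -innerNl -innerDl -wE.
  rewrite innerDl !(innerDr x) !(innerDr (s *: w)) !innerZl !innerZr xPw Qx0.
  by ring.
rewrite -normr_eq0 -sqrf_eq0 sqr_normE.
pose q := '[w, w - P w]; pose N := '[w, w].
have q0 : 0 <= q by exact: Q_ge0.
have N0 : 0 <= N by exact: inner_ge0.
(* With q + 1 instead of q the step t is defined also when q = 0. *)
have q1 : 1 + q != 0 by rewrite gt_eqF// addrC ltr_wpDl.
pose t := N / (1 + q).
have tN : t * (1 + q) = N by rewrite divfK.
have t0 : 0 <= t by rewrite divr_ge0// addr_ge0.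
have := Q_ge0 (x + (- t) *: w); rewrite expand -/q -/N -tN => le0.
have : t ^+ 2 == 0 by rewrite eq_le sqr_ge0 andbT; nra.
by rewrite sqrf_eq0 => /eqP ->; rewrite mul0r.
Qed.

End SnapshotSpans.

(** * Block triangular and positive definite matrices *)

(** Block conditions become conditions on entries, graded by the number of the
    block that contains an index. *)
Lemma submxblock_eq0P (T : nmodType) (n m : nat) (A : blockmx T n m)
    (Q : rel 'I_n) :
  (forall i j, Q i j -> submxblock A i j = 0) <->
  (forall s t, Q (tagnat.sig1 s) (tagnat.sig1 t) -> A s t = 0).
Proof.
split=> A0 => [s t Qst|i j Qij].
  have := congr1 (fun B : 'M[T]_(m, m) =>
    B (tagnat.sig2 s) (tagnat.sig2 t)) (A0 _ _ Qst).
  by rewrite !mxE !tagnat.sig2K.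
by apply/matrixP => k l; rewrite !mxE A0// !tagnat.Rank1K.
Qed.

Section GradedMatrices.
Context {F : fieldType} {N : nat} (lv : 'I_N -> nat).
Implicit Types A : 'M[F]_N.

Definition upper_graded A := forall s t, (lv t < lv s)%N -> A s t = 0.

(** Being upper graded means that, for each k, right multiplication preserves
    the space of row vectors supported on the levels at least k.  An invertible map
    that preserves a finite-dimensional space maps it onto itself, and so does
    its inverse. *)
Lemma upper_graded_invmx A :
  A \in unitmx -> upper_graded A -> upper_graded (invmx A).
Proof.
move=> Au Aup s t st; set k := lv s in st.
(* The row space of this projection consists of the vectors just described. *)
pose V : 'M[F]_N := diag_mx (\row_q ((k <= lv q)%N)%:R).
have VE (B : 'M[F]_N) p q : (V *m B) p q = ((k <= lv p)%N)%:R * B p q.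
  by rewrite mul_diag_mx !mxE.
have EV (B : 'M[F]_N) p q : (B *m V) p q = B p q * ((k <= lv q)%N)%:R.
  by rewrite mul_mx_diag !mxE.
have VAV : V *m A *m V = V *m A.
  apply/matrixP => p q; rewrite EV VE.
  have [kp|_] := leqP k (lv p); last by rewrite !mul0r.
  have [pq|qp] := leqP (lv p) (lv q); first by rewrite (leq_trans kp pq) mulr1.
  by rewrite Aup// mulr0 mul0r.
have stable : (V *m invmx A <= V)%MS.
  have VA : (V *m A <= V)%MS by rewrite -VAV submxMl.
  have : (V <= V *m A)%MS.
    by rewrite -(geq_leqif (mxrank_leqif_sup VA)) mxrankMfree// row_free_unit.
  by move=> /(submxMr (invmx A)); rewrite mulmxK.
have /submxP[D VD] := stable.
have VV : V *m V = V.
  apply/matrixP => p q; rewrite EV !mxE.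
  have [->|] := eqVneq p q; last by rewrite mulr0n mul0r.
  by case: leqP; rewrite ?mulr1 ?mul0r ?mulr1n// mul0r.
have : V *m invmx A *m V = V *m invmx A by rewrite VD -mulmxA VV.
move=> /matrixP/(_ s t); rewrite EV VE leqnn mul1r leqNgt st mulr0.
exact: esym.
Qed.

End GradedMatrices.

Section PositiveDefinite.
Context {R : rcfType}.

Definition posdef_mx {N : nat} (A : 'M[R]_N) :=
  forall x : 'rV_N, x != 0 -> 0 < (x *m A *m x^T) 0 0.

Lemma posdef_unitmx N (A : 'M[R]_N) : posdef_mx A -> A \in unitmx.
Proof.
move=> Apos; rewrite -row_free_unit -kermx_eq0; apply/negPn/negP => /rowV0Pn[x].
by move=> /sub_kermxP xA0 /Apos; rewrite xA0 mul0mx mxE ltxx.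
Qed.

(** Elimination of the first variable: the Schur complement
    B - a^-1 v v^T of the first diagonal entry is again positive definite. *)
Lemma cholesky_exists N (A : 'M[R]_N) : A^T = A -> posdef_mx A ->
  exists L : 'M[R]_N,
    (forall s t : 'I_N, (s < t)%N -> L s t = 0) /\ A = L *m L^T.
Proof.
elim: N A => [|N IH] A A_sym Apos.
  by exists 0; split=> [[]//|]; apply/matrixP => -[].
rewrite -[N.+1]/(1 + N)%N in A A_sym Apos *.
pose a := A 0 0.
pose v := dlsubmx A; pose B := drsubmx A.
have Aul : ulsubmx A = a%:M.
  by rewrite [LHS]mx11_scalar !mxE; congr ((A _ _)%:M); apply/val_inj.
have AE : A = block_mx a%:M v^T v B.
  by rewrite /v trmx_dlsub A_sym -Aul submxK.
have a0 : 0 < a.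
  have := Apos (row_mx 1 0); rewrite AE mul_row_block tr_row_mx mul_row_col.
  rewrite !(mul0mx, mul1mx, trmx0, trmx1, mulmx1, mulmx0, addr0) !mxE mulr1n.
  by apply; rewrite row_mx_eq0 oner_eq0.
have B_sym : B^T = B by rewrite /B trmx_drsub A_sym.
pose B' := B - a^-1 *: (v *m v^T).
have B'_sym : B'^T = B'.
  by rewrite /B' linearB linearZ/= trmx_mul trmxK B_sym.
have B'pos : posdef_mx B'.
  (* The first coordinate minimizes the form of A for the given y. *)
  move=> y y0; pose al := - (a^-1 *: (y *m v)).
  have := Apos (row_mx al y); rewrite AE mul_row_block tr_row_mx mul_row_col.
  have -> : al *m a%:M + y *m v = 0.
    by rewrite mul_mx_scalar /al scalerN scalerA mulfV ?gt_eqF// scale1r addNr.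
  have -> : al *m v^T + y *m B = y *m B'.
    by rewrite /al /B' mulmxBr -scalemxAr mulNmx -scalemxAl mulmxA addrC.
  rewrite mul0mx add0r; apply.
  by rewrite row_mx_eq0 negb_and y0 orbT.
have [L' [L'low B'E]] := IH _ B'_sym B'pos.
pose r := Num.sqrt a; have r0 : r != 0 by rewrite gt_eqF// sqrtr_gt0.
have rr : r * r = a by rewrite -expr2 sqr_sqrtr// ltW.
exists (block_mx r%:M 0 (r^-1 *: v) L'); split.
  move=> s t; rewrite -[s]fintype.splitK -[t]fintype.splitK.
  case: (fintype.split s) => i; case: (fintype.split t) => j /=;
    rewrite ?block_mxEul ?block_mxEur ?block_mxEdl ?block_mxEdr.
  - by rewrite !ord1.
  - by rewrite mxE.
  - by rewrite ord1.
  - by move=> ij; apply: L'low.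
rewrite tr_block_mx mulmx_block !(trmx0, mul0mx, mulmx0, addr0) tr_scalar_mx.
rewrite -B'E -scalar_mxM rr mul_scalar_mx mul_mx_scalar.
rewrite linearZ/= !scalerA mulfV// !scale1r -scalemxAl -scalemxAr scalerA.
rewrite -invfM rr.
by rewrite /B' addrC subrK.
Qed.

Lemma posdef_mx_congruence N (A K : 'M[R]_N) (a : R) :
  0 < a -> K \in unitmx -> posdef_mx A -> posdef_mx (a *: (K^T *m A *m K)).
Proof.
move=> a0 Ku Apos x x0; rewrite -scalemxAr -scalemxAl mxE mulr_gt0//.
have := Apos (x *m K^T); rewrite trmx_mul trmxK !mulmxA; apply.
apply: contra_neq x0 => /(congr1 (mulmx^~ (invmx K^T))).
by rewrite mulmxK ?unitmx_tr// mul0mx.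
Qed.

(** Column t of [invmx L^T] is supported on the levels up to lv t, and row s of
    [G] on the levels from lv s - 1 on.  The two do not meet if
    lv t + 1 < lv s, so that the entry (s, t) of L = G L^(-T) vanishes. *)
Lemma tridiagonal_cholesky N (lv : 'I_N -> nat) (G L : 'M[R]_N) :
    G \in unitmx ->
    (forall s t, ((lv s).+1 < lv t)%N || ((lv t).+1 < lv s)%N -> G s t = 0) ->
    (forall s t, (lv s < lv t)%N -> L s t = 0) -> G = L *m L^T ->
  L \in unitmx /\ forall s t, ((lv t).+1 < lv s)%N -> L s t = 0.
Proof.
move=> Gu Gtri Llow GE.
have Lu : L \in unitmx by move: Gu; rewrite GE unitmx_mul => /andP[].
split=> // s t ts.
have LTu : L^T \in unitmx by rewrite unitmx_tr.
have LTup : upper_graded lv L^T by move=> p q pq; rewrite mxE Llow.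
have Kup := upper_graded_invmx LTu LTup.
have -> : L = G *m invmx L^T by rewrite GE mulmxK.
rewrite mxE big1// => q _.
have [tq|qt] := ltnP (lv t) (lv q); first by rewrite Kup// mulr0.
by rewrite Gtri ?mul0r// (leq_trans _ ts) ?orbT// !ltnS.
Qed.

End PositiveDefinite.

(** * The reduced order model *)

Section SnapshotMatrices.
Context {R : realType} {H : hilbertSpace R} {m : nat}.
Variables (u : nat -> 'I_m -> H) (n : nat).
Local Notation N := (\sum_(i < n) m)%N.
Implicit Types (s t q : 'I_N).

Definition snapshot s : H := u (tagnat.sig1 s) (tagnat.sig2 s).

Lemma snapshot_Rank (i : 'I_n) (r : 'I_m) :
  snapshot (@tagnat.Rank n (fun=> m) i r) = u i r.
Proof.
pose f (p : {_ : 'I_n & 'I_m}) := u (tag p) (tagged p).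
by rewrite -[LHS]/(f (tagnat.sig _)) tagnat.rankK.
Qed.

Definition snapshot_comb p (K : 'M[R]_(N, p)) (i : 'I_p) : H :=
  \sum_s K s i *: snapshot s.

(** With [T] the identity, the propagator P or I - P this is the mass matrix, the
    stiffness matrix or their difference. *)
Definition form_mx (T : H -> H) : 'M[R]_N :=
  \matrix_(s, t) '[snapshot s, T (snapshot t)].

Lemma mass_mxE : mass_mx n u = form_mx idfun.
Proof. by apply/matrixP => s t; rewrite !mxE. Qed.

Lemma stiffness_mxE (P : H -> H) : stiffness_mx n P u = form_mx P.
Proof. by apply/matrixP => s t; rewrite !mxE. Qed.

Lemma inner_combr (T : {linear H -> H}) x p (K : 'M[R]_(N, p)) j :
  '[x, T (snapshot_comb K j)] = \sum_t '[x, T (snapshot t)] * K t j.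
Proof.
rewrite linear_sum (linear_sumr (inner H)); apply: eq_bigr => t _.
by rewrite linearZ/= innerZr mulrC.
Qed.

Lemma form_mx_mull (T : H -> H) p (K : 'M[R]_(N, p)) i t :
  (K^T *m form_mx T) i t = '[snapshot_comb K i, T (snapshot t)].
Proof.
rewrite mxE innerC (inner_combr idfun).
by apply: eq_bigr => s _; rewrite !mxE mulrC innerC.
Qed.

Lemma form_mx_comb (T : {linear H -> H}) p (K : 'M[R]_(N, p)) i j :
  (K^T *m form_mx T *m K) i j = '[snapshot_comb K i, T (snapshot_comb K j)].
Proof.
by rewrite inner_combr mxE; apply: eq_bigr => t _; rewrite form_mx_mull.
Qed.

Lemma snapshot_comb_span p (K : 'M[R]_(N, p)) i k :
    (forall s, (k <= tagnat.sig1 s)%N -> K s i = 0) ->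
  snapshot_span u k (snapshot_comb K i).
Proof.
move=> K0; apply: snapshot_span_sum => s.
have [sk|ks] := ltnP (tagnat.sig1 s) k.
  by apply: snapshot_spanZ; exact: snapshot_span_gen.
by rewrite K0// scale0r; exact: snapshot_span0.
Qed.

Lemma snapshot_comb_eq0 (x : 'rV[R]_N) :
  lin_indep_upto n u -> snapshot_comb x^T 0 = 0 -> x = 0.
Proof.
move=> indep comb0; apply/rowP => s; rewrite mxE.
pose y (i : 'I_n) (r : 'I_m) : R := x 0 (@tagnat.Rank n (fun=> m) i r).
(* Independence holds up to time n; the coefficients at time n are 0. *)
pose c (j : 'I_n.+1) r := if insub (j : nat) is Some i then y i r else 0.
have cE (i : 'I_n) r : c (widen_ord (leqnSn n) i) r = y i r.
  by rewrite /c /= valK.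
have -> : x 0 s = y (tagnat.sig1 s) (tagnat.sig2 s) by rewrite /y tagnat.sig2K.
rewrite -cE; apply: indep.
rewrite big_ord_recr/= [X in _ + X]big1 ?addr0; last first.
  by move=> r _; rewrite /c insubF ?ltnn// scale0r.
rewrite -[RHS]comb0 /snapshot_comb.
under eq_bigr => i _ do under eq_bigr => r _ do rewrite cE.
rewrite sig_big_dep/= (reindex _ (@tagnat.sig_bij_on n (fun=> m)))/=.
by apply: eq_bigr => t _; rewrite mxE /y /snapshot tagnat.sig2K.
Qed.

Lemma form_mx_posdef (T : {linear H -> H}) : lin_indep_upto n u ->
    (forall x, snapshot_span u n x -> x != 0 -> 0 < '[x, T x]) ->
  posdef_mx (form_mx T).
Proof.
move=> indep Tpos x x0; rewrite -{1}[x]trmxK form_mx_comb; apply: Tpos.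
  by apply: snapshot_comb_span => s; rewrite leqNgt ltn_ord.
by apply: contra_neq x0; exact: snapshot_comb_eq0.
Qed.

End SnapshotMatrices.

Section RomPropagator.
Context {R : realType} {H : hilbertSpace R} {m n : nat}.
Variables (T : {linear H -> H}) (u : nat -> 'I_m -> H) (C : blockmx R n m).
Hypothesis T_sym : forall x y, '[T x, y] = '[x, T y].
Hypothesis T_le : forall x, '[T x, x] <= '[x, x].
Hypothesis T0 : forall r, T (u 0 r) = u 1 r.
Hypothesis TS : forall j r, T (u j.+1 r) = 2^-1 *: (u j.+2 r + u j r).
Hypothesis indep : lin_indep_upto n u.
Hypothesis cholC : block_cholesky_upper (mass_mx n u) C.

Local Notation level s := (nat_of_ord (tagnat.sig1 s)).
Local Notation PROM := (rom_propagator (stiffness_mx n T u) C).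
Local Notation V := (snapshot_comb u (invmx C)).

Let formE : form_mx u n idfun = C^T *m C.
Proof. by rewrite -mass_mxE; exact: cholC.2. Qed.

Let C_upper : upper_graded (fun s => level s) C :=
  (submxblock_eq0P C (fun i j => (j < i)%N)).1 cholC.1.

Let C_unit : C \in unitmx.
Proof.
have : form_mx u n idfun \in unitmx.
  apply: posdef_unitmx; apply: (form_mx_posdef (T := idfun) indep) => x _ x0.
  by rewrite -sqr_normE exprn_gt0// normr_gt0.
by rewrite formE unitmx_mul => /andP[].
Qed.

Let invC_upper : upper_graded (fun s => level s) (invmx C) :=
  upper_graded_invmx C_unit C_upper.

Lemma rom_propagatorE s t : PROM s t = '[V s, T (V t)].
Proof. by rewrite -form_mx_comb -stiffness_mxE. Qed.

Lemma rom_propagator_sym : PROM^T = PROM.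
Proof. by apply/matrixP => s t; rewrite mxE !rom_propagatorE -T_sym innerC. Qed.

(** The Gram matrix of the orthonormal basis against the snapshots is
    C^(-T) M = C, which is block upper triangular. *)
Lemma rom_basis_ortho s k x :
  (k <= level s)%N -> snapshot_span u k x -> '[V s, x] = 0.
Proof.
move=> ks; apply: (snapshot_span_ind (Q := fun x => '[V s, x] = 0)).
- by rewrite linear0r.
- by move=> a y z y0 z0; rewrite innerDr innerZr y0 z0 mulr0 addr0.
move=> j r jk.
have jn : (j < n)%N := leq_trans jk (leq_trans ks (ltnW (ltn_ord _))).
pose q := @tagnat.Rank n (fun=> m) (Ordinal jn) r.
have -> : u j r = snapshot u q by rewrite snapshot_Rank.
rewrite -(form_mx_mull u idfun (invmx C)) formE mulmxA -trmx_mul mulmxV//.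
rewrite trmx1 mul1mx C_upper// tagnat.Rank1K.
exact: leq_trans jk ks.
Qed.

Lemma rom_basis_span t : snapshot_span u (level t).+1 (V t).
Proof. by apply: snapshot_comb_span => s ts; rewrite invC_upper. Qed.

Lemma rom_propagator_tridiagonal s t :
  ((level s).+1 < level t)%N || ((level t).+1 < level s)%N -> PROM s t = 0.
Proof.
wlog st : s t / ((level t).+1 < level s)%N => [hwlog|_].
  case/orP => h; last by apply: hwlog => //; rewrite h orbT.
  by rewrite -rom_propagator_sym mxE; apply: hwlog => //; rewrite h orbT.
rewrite rom_propagatorE; apply: rom_basis_ortho st _.
by apply: propagator_span => //; exact: rom_basis_span.
Qed.

(** Since C^(-T) M C^-1 is the identity, I - PROM is congruent to M - S, the
    matrix of the form <x, (I - P) x> on the snapshots. *)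
Lemma rom_propagator_posdef (a : R) :
  0 < a -> posdef_mx (a *: (1%:M - PROM)).
Proof.
pose D : {linear H -> H} := idfun \- T.
have -> : 1%:M - PROM = (invmx C)^T *m form_mx u n D *m invmx C.
  have -> : form_mx u n D = form_mx u n idfun - form_mx u n T.
    by apply/matrixP => s t; rewrite !mxE innerDr innerNr.
  rewrite mulmxBr mulmxBl formE mulmxA -trmx_mul mulmxV// trmx1 mul1mx.
  by rewrite mulmxV// -stiffness_mxE.
move=> a0; apply: posdef_mx_congruence => //; first by rewrite unitmx_inv.
by apply: form_mx_posdef => // x; exact: sub_propagator_gt0.
Qed.

End RomPropagator.

Theorem theorem2p4 (R : realType) (K H : hilbertSpace R)
  (* the operator L(q) : K -> H, and A = L(q) L(q)^T *)
  (L : set (K * H)) (A : set (H * H))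
  (hL : densely_defined_operator L)
  (hA : A = comp_op L (adjoint L))
  (hAsa : self_adjoint A) (hApos : nonneg_op A)
  (E : projMeasure H) (hE : spectral_measure_of E A)
  (tau : R) (htau : 0 < tau)
  (n m : nat) (hn : (1 <= n)%N) (hm : (1 <= m)%N)
  (P : H -> H) (hP : forall x, is_cos_sqrt E tau x (P x))
  (b : 'I_m -> H) (u : nat -> 'I_m -> H)
  (hu : forall j r, is_cos_sqrt E (j%:R * tau) (b r) (u j r))
  (hindep : lin_indep_upto n u)
  (C : blockmx R n m) (hC : block_cholesky_upper (mass_mx n u) C) :
  let PROM : blockmx R n m := rom_propagator (stiffness_mx n P u) C in
  [/\ PROM^T = PROM,
      block_tridiagonal PROM,
      1%:M - PROM \in unitmx,
      exists LROM : blockmx R n m,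
        block_cholesky_lower ((2 / tau ^+ 2) *: (1%:M - PROM)) LROM
    & forall LROM : blockmx R n m,
        block_cholesky_lower ((2 / tau ^+ 2) *: (1%:M - PROM)) LROM ->
        LROM \in unitmx /\ block_lower_bidiagonal LROM].
Proof.
move=> PROM.
pose T : {linear H -> H} :=
  HB.pack P (GRing.isLinear.Build _ _ _ _ P (cos_propagator_linear hP)).
have T_sym x y : '[T x, y] = '[x, T y] := cos_propagator_sym hP x y.
have T_le x : '[T x, x] <= '[x, x] := cos_propagator_le hP x.
have T0 r : T (u 0 r) = u 1 r := cos_propagator0 hP (hu^~ r).
have TS j r : T (u j.+1 r) = 2^-1 *: (u j.+2 r + u j r) :=
  cos_propagatorS hP (hu^~ r) j.
have PROM_sym : PROM^T = PROM := rom_propagator_sym u C T_sym.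
have PROM_tri s t : _ -> PROM s t = 0 :=
  @rom_propagator_tridiagonal _ _ _ _ T u C T_sym T0 TS hindep hC s t.
have PROM_pos a : 0 < a -> posdef_mx (a *: (1%:M - PROM)) :=
  rom_propagator_posdef T_sym T_le T0 TS hindep hC (a := a).
clearbody PROM.
pose c := 2 / tau ^+ 2; pose G := c *: (1%:M - PROM).
have c0 : 0 < c by rewrite divr_gt0// exprn_gt0.
have G_unit : G \in unitmx by apply: posdef_unitmx; exact: PROM_pos.
have G_sym : G^T = G by rewrite /G linearZ linearB/= trmx1 PROM_sym.
have G_tri s t :
    ((tagnat.sig1 s).+1 < tagnat.sig1 t)%N ||
    ((tagnat.sig1 t).+1 < tagnat.sig1 s)%N -> G s t = 0.
  move=> st; rewrite !mxE PROM_tri// subr0.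
  have [sEt|_] := eqVneq s t; last by rewrite mulr0.
  by move: st; rewrite sEt orbb => /ltnW; rewrite ltnn.
split=> //.
- exact/(submxblock_eq0P PROM (fun i j => (i.+1 < j)%N || (j.+1 < i)%N)).
- by rewrite -[_ - _]scale1r; apply: posdef_unitmx; exact: PROM_pos.
- have [LR [LRlow GE]] := cholesky_exists G_sym (PROM_pos _ c0).
  exists LR; split=> //.
  apply/(submxblock_eq0P LR (fun i j => (i < j)%N)) => s t st.
  (* The block number is a nondecreasing function of the index. *)
  apply: LRlow; rewrite ltnNge; apply: contraL st => ts; rewrite -leqNgt.
  exact: tagnat.le_sig1.
move=> LR [LRlow GE].
have {}LRlow := (submxblock_eq0P LR (fun i j => (i < j)%N)).1 LRlow.
have [LRu LRbi] := tridiagonal_cholesky G_unit G_tri LRlow GE.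
split=> //.
apply/(submxblock_eq0P LR (fun i j => ~~ ((i == j) || (i == j.+1 :> nat)))).
move=> s t; rewrite negb_or => /andP[st st1].
have [ts|ts] := ltnP (tagnat.sig1 s) (tagnat.sig1 t); first exact: LRlow.
by apply: LRbi; rewrite ltn_neqAle eq_sym st1 ltn_neqAle ts andbT eq_sym.
Qed.
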